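(* Let $n\ge 1$ and let $b_1,\dots,b_{n+1},d_1,\dots,d_n$ be nonzero integers. Let $D$ be the $2$-bridge knot (or link) diagram with continued fraction notation $F(D)=[b_1,d_1,b_2,d_2,\dots,d_n,b_{n+1}]$. Then the Kauffman polynomial of $D$ is $$\langle D\rangle=(0,0,\delta)\,B(b_{n+1})\,D(d_n)\,B(b_n)\,D(d_{n-1})\cdots B(b_{i+1})\,D(d_i)\cdots B(b_2)\,D(d_1)\,B_1(b_1)\begin{pmatrix}1\\1\\1\end{pmatrix},$$ where $\delta=\frac{\alpha-\alpha^{-1}}{s-s^{-1}}+1$ and, for a nonzero integer $k$, the $3\times3$ matrices over $\mathbb{Q}(\alpha,s)$ are $$D(k)=\begin{pmatrix}s^{k}&0&0\\0&(-s^{-1})^{k}&0\\0&0&\alpha^{-k}\end{pmatrix},\qquad B(k)=M\begin{pmatrix}s^{k}&0&0\\0&(-s^{-1})^{k}&0\\0&0&\alpha^{-k}\end{pmatrix}M,$$ and $B_1(k)$ is the diagonal matrix whose $(i,i)$ entry is $m_{i1}s^{k}+m_{i2}(-s^{-1})^{k}+m_{i3}\alpha^{-k}$ for $i=1,2,3$. Here $M=(m_{ij})$ is the $3\times 3$ matrix with entries $$m_{11}=\tfrac{s^{-1}-\delta^{-1}s^{-1}-\delta^{-1}\alpha^{-1}}{s+s^{-1}},\quad m_{12}=\tfrac{-s^{-1}-\delta^{-1}s+\delta^{-1}\alpha^{-1}}{s+s^{-1}},\quad m_{13}=\delta^{-1},$$ $$m_{21}=\tfrac{-s-\delta^{-1}s^{-1}-\delta^{-1}\alpha^{-1}}{s+s^{-1}},\quad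 m_{22}=\tfrac{s-\delta^{-1}s+\delta^{-1}\alpha^{-1}}{s+s^{-1}},\quad m_{23}=\delta^{-1},$$ $$m_{31}=\tfrac{s^{-1}\delta+\alpha-\delta^{-1}s^{-1}-\delta^{-1}\alpha^{-1}}{s+s^{-1}},\quad m_{32}=\tfrac{s\delta-\alpha-\delta^{-1}s+\delta^{-1}\alpha^{-1}}{s+s^{-1}},\quad m_{33}=\delta^{-1}.$$
   Context: Tangles. A $4$-ended tangle is a framed unoriented $1$-manifold properly embedded in the ball $B^3$ (closed curves and arcs) with boundary four fixed coplanar points $N,E,S,W$ on $\partial B^3$, drawn as a diagram in a square with $N$ the top-left, $E$ the top-right, $S$ the bottom-right and $W$ the bottom-left corner. Diagrams (of tangles and links) carry the vertical framing pointing towards the reader (blackboard framing). Write $I_v$ for the crossingless tangle with arcs $N$–$W$ and $E$–$S$ (two vertical arcs), $I_h$ for the crossingless tangle with arcs $N$–$E$ and $W$–$S$ (two horizontal arcs), $\sigma$ for the one-crossing tangle with straight arcs $N$–$S$ and $E$–$W$ in which $N$–$S$ passes over $E$–$W$, and $\sigma^{-1}$ for the one-crossing tangle in which $E$–$W$ passes over $N$–$S$. Operations. $x\odot y$ (concatenation) stacks $x$ on top of $y$, gluing the points $W,S$ of $x$ to the points $N,E$ of $y$ respectively. $x\otimes y$ (juxtaposition) places $x$ to the left of $y$, gluing the points $E,S$ of $x$ to the points $N,W$ of $y$ respectively. Put $\sigma_h=\sigma^{-1}$ as a tangle; its inverse for $\otimes$ is the tangle $\sigma$. For an integer $k>0$,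 $\sigma_\odot^{k}$ is the $\odot$-product of $k$ copies of $\sigma$ and $\sigma_\odot^{-k}$ is the $\odot$-product of $k$ copies of $\sigma^{-1}$; $(\sigma_h)_\otimes^{k}$ is the $\otimes$-product of $k$ copies of $\sigma_h$ and $(\sigma_h)_\otimes^{-k}$ is the $\otimes$-product of $k$ copies of the tangle $\sigma$. (A vertical row $\sigma_\odot^{k}$ or horizontal row $(\sigma_h)_\otimes^k$ with $k>0$ is called a left-hand twist, and with $k<0$ a right-hand twist.) The diagram $D$. The $2$-bridge diagram with continued fraction notation $F(D)=[b_1,d_1,b_2,\dots,d_n,b_{n+1}]$ is constructed as follows: $T_1=I_h\otimes\sigma_\odot^{b_1}$, and for $i=1,\dots,n$, $T_{i+1}=\bigl(T_i\otimes(\sigma_h)_\otimes^{d_i}\bigr)\odot\sigma_\odot^{b_{i+1}}$; then $D$ is the closure of $T_{n+1}$ obtained by joining $N$ to $W$ and $E$ to $S$ by two disjoint crossingless arcs outside the square (one on the left, one on the right). $D$ is regarded as a framed link with blackboard framing. Kauffman polynomial. $\mathbb{Q}(\alpha,s)$ is the field of rational functions in $\alpha,s$. The Kauffman polynomial $\langle L\rangle\in\mathbb{Q}(\alpha,s)$ of a framed unoriented link $L$ is the unique invariant of framed links (up to framed isotopy) with $\langle\emptyset\rangle=1$ satisfying the relations (the first two being local, i.e. the diagrams are identical outside a disk): (i) $\sigma-\sigma^{-1}=(s-s^{-1})(I_v-I_h)$; (ii) removing the curl formed by joining the ends $W$ and $S$ of $\sigma^{-1}$ by a crossingless arc (replacing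 it by a crossingless arc from $N$ to $E$) multiplies by $\alpha$, that is, curl $=\alpha\cdot$ arc; (iii) $L\sqcup O=\delta L$ for $O$ a crossingless null-homotopic circle. *)

(* Defs.v *)
From HB Require Import structures.
From mathcomp Require Import all_boot all_order all_algebra.

Set Implicit Arguments.
Unset Strict Implicit.
Unset Printing Implicit Defensive.

Import GRing.Theory.

(* Diagrams of framed unoriented tangles are put in Morse position and read   *)
(* from top to bottom: a word is a sequence of elementary layers, each one    *)
(* acting on adjacent strands while the other strands go straight down.       *)
(* The framing is the blackboard framing.  A layer (i, g) leaves i strands on *)
(* the left of the elementary piece g:                                        *)
(*   - Max creates the adjacent strands i, i+1 (a local maximum);             *)
(*   - Min joins the adjacent strands i, i+1 (a local minimum);               *)
(*   - Cross over crosses the strands i, i+1; the strand going from top-left  *)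
(*     to bottom-right is the upper one iff over = true.                      *)
Variant piece := Max | Min | Cross of bool.
Definition layer := (nat * piece)%type.
Definition word := seq layer.

Definition inputs (g : piece) : nat := if g is Max then 0 else 2.
Definition outputs (g : piece) : nat := if g is Min then 0 else 2.

(* w is a tangle diagram with m endpoints on top and n at the bottom.         *)
Fixpoint is_tangle (m n : nat) (w : word) : bool :=
  if w is (i, g) :: w' then
    (i + inputs g <= m) && is_tangle (m - inputs g + outputs g) n w'
  else m == n.

Definition is_link (w : word) : bool := is_tangle 0 0 w.

(* k vertical strands added on the left.  Strands may be added on the right   *)
(* without changing the word.                                                 *)
Definition shift (k : nat) (w : word) : word := [seq (k + g.1, g.2) | g <- w].

(* The local moves generating isotopy of blackboard-framed diagrams: planar   *)
(* isotopy (the first three, and the two slides of a strand across a local    *)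
(* extremum, which also account for rotating a crossing), Reidemeister II and *)
(* III, and the framed version of Reidemeister I, which exchanges two curls   *)
(* with the same writhe and opposite rotation numbers.  The remaining forms   *)
(* of these moves are obtained by composition.                                *)
Variant local_move : word -> word -> Prop :=
| move_exchange i k g h :
    local_move [:: (i, g); (i + outputs g + k, h)]
               [:: (i + inputs g + k, h); (i, g)]
| move_zigzag_right i : local_move [:: (i.+1, Max); (i, Min)] [::]
| move_zigzag_left i : local_move [:: (i, Max); (i.+1, Min)] [::]
| move_slide_max i o :
    local_move [:: (i, Max); (i.+1, Cross o)] [:: (i.+1, Max); (i, Cross (~~ o))]
| move_slide_min i o :
    local_move [:: (i.+1, Cross o); (i, Min)] [:: (i, Cross (~~ o)); (i.+1, Min)]
| move_R2 i o : local_move [:: (i, Cross o); (i, Cross (~~ o))] [::]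
| move_R3 i o :
    local_move [:: (i, Cross o); (i.+1, Cross o); (i, Cross o)]
               [:: (i.+1, Cross o); (i, Cross o); (i.+1, Cross o)]
| move_framed_R1 i o :
    local_move [:: (i.+1, Max); (i, Cross o); (i.+1, Min)]
               [:: (i, Max); (i.+1, Cross o); (i, Min)].

Inductive framed_isotopic : word -> word -> Prop :=
| isotopic_refl L : is_link L -> framed_isotopic L L
| isotopic_sym L L' : framed_isotopic L L' -> framed_isotopic L' L
| isotopic_trans L L' L'' :
    framed_isotopic L L' -> framed_isotopic L' L'' -> framed_isotopic L L''
| isotopic_move u w w' v :
    local_move w w' -> is_link (u ++ w ++ v) -> is_link (u ++ w' ++ v) ->
    framed_isotopic (u ++ w ++ v) (u ++ w' ++ v).

(* A 4-ended tangle is a word w with is_tangle 2 2 w: the endpoints N, E are  *)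
(* on top and W, S at the bottom, from left to right.                         *)
Definition I_v : word := [::].
Definition I_h : word := [:: (0, Min); (0, Max)].
Definition sigma : word := [:: (0, Cross true)].
Definition sigma_inv : word := [:: (0, Cross false)].
Definition sigma_h : word := sigma_inv.

Definition odot (x y : word) : word := x ++ y.

(* The four ends on top of x and y are N_x, E_x, N_y, E_y: a local maximum    *)
(* joins E_x to N_y, and a local minimum joins S_x to W_y.                    *)
Definition otimes (x y : word) : word :=
  [:: (1, Max)] ++ x ++ shift 2 y ++ [:: (1, Min)].

(* The values at k = 0 are the units I_v of odot and I_h of otimes.           *)
Fixpoint odot_pow (x : word) (k : nat) : word :=
  match k with
  | 0 => I_v
  | 1 => x
  | k'.+1 => odot (odot_pow x k') x
  end.

Fixpoint otimes_pow (x : word) (k : nat) : word :=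
  match k with
  | 0 => I_h
  | 1 => x
  | k'.+1 => otimes (otimes_pow x k') x
  end.

Definition vertical_row (k : int) : word :=
  if k is Negz k' then odot_pow sigma_inv k'.+1 else odot_pow sigma `|k|%N.

Definition horizontal_row (k : int) : word :=
  if k is Negz k' then otimes_pow sigma k'.+1 else otimes_pow sigma_h `|k|%N.

(* two_bridge_tangle b d i is T_{i+1}; the sequences b and d are read from    *)
(* index 1 on.                                                                *)
Fixpoint two_bridge_tangle (b d : nat -> int) (i : nat) : word :=
  if i is i'.+1 then
    odot (otimes (two_bridge_tangle b d i') (horizontal_row (d i)))
         (vertical_row (b i.+1))
  else otimes I_h (vertical_row (b 1)).

(* N is joined to W on the left of the square, and E to S on its right.       *)
Definition closure (t : word) : word :=
  [:: (0, Max); (2, Max)] ++ shift 1 t ++ [:: (0, Min); (0, Min)].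

(* The diagram with notation [b_1, d_1, b_2, ..., d_n, b_{n+1}].              *)
Definition two_bridge (b d : nat -> int) (n : nat) : word :=
  closure (two_bridge_tangle b d n).

Local Open Scope ring_scope.

Definition Qas := {fraction {poly {poly rat}}}.
Definition alpha : Qas := tofrac ('X%:P).
Definition s : Qas := tofrac 'X.

Definition delta : Qas := (alpha - alpha^-1) / (s - s^-1) + 1.

(* These properties determine K on the words w such that is_link w; the other *)
(* values of K are irrelevant.  A disk in which diagrams differ is put in the *)
(* position shift i _, between a part u of the diagram above it and a part v  *)
(* below it.                                                                  *)
Record kauffman_polynomial (K : word -> Qas) : Prop := KauffmanPolynomial {
  kauffman_isotopy : forall L L', framed_isotopic L L' -> K L = K L';
  kauffman_empty : K [::] = 1;
  kauffman_skein : forall (u v : word) (i : nat),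
    is_link (u ++ shift i sigma ++ v) ->
    K (u ++ shift i sigma ++ v) - K (u ++ shift i sigma_inv ++ v) =
    (s - s^-1) * (K (u ++ shift i I_v ++ v) - K (u ++ shift i I_h ++ v));
  kauffman_curl : forall (u v : word) (i : nat),
    is_link (u ++ shift i (sigma_inv ++ [:: (0%N, Min)]) ++ v) ->
    K (u ++ shift i (sigma_inv ++ [:: (0%N, Min)]) ++ v) =
    alpha * K (u ++ shift i [:: (0%N, Min)] ++ v);
  kauffman_circle : forall L : word, is_link L ->
    K (L ++ [:: (0%N, Max); (0%N, Min)]) = delta * K L
}.

Definition M_entries : seq (seq Qas) :=
  [:: [:: (s^-1 - delta^-1 * s^-1 - delta^-1 * alpha^-1) / (s + s^-1);
          (- s^-1 - delta^-1 * s + delta^-1 * alpha^-1) / (s + s^-1);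
          delta^-1];
      [:: (- s - delta^-1 * s^-1 - delta^-1 * alpha^-1) / (s + s^-1);
          (s - delta^-1 * s + delta^-1 * alpha^-1) / (s + s^-1);
          delta^-1];
      [:: (s^-1 * delta + alpha - delta^-1 * s^-1 - delta^-1 * alpha^-1)
            / (s + s^-1);
          (s * delta - alpha - delta^-1 * s + delta^-1 * alpha^-1)
            / (s + s^-1);
          delta^-1]].

Definition Mmx : 'M[Qas]_3 := \matrix_(i, j) (nth [::] M_entries i)`_j.

Definition twist_row (k : int) : 'rV[Qas]_3 :=
  \row_j [:: s ^ k; (- s^-1) ^ k; alpha ^ (- k)]`_j.

Definition Dmx (k : int) : 'M[Qas]_3 := diag_mx (twist_row k).

Definition Bmx (k : int) : 'M[Qas]_3 := Mmx *m Dmx k *m Mmx.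

Definition B1mx (k : int) : 'M[Qas]_3 :=
  diag_mx (\row_i (Mmx i 0 * s ^ k + Mmx i 1 * (- s^-1) ^ k
                   + Mmx i 2%:R * alpha ^ (- k))).

Lemma is_tangle_cat m n w w' p :
  is_tangle m n w -> is_tangle n p w' -> is_tangle m p (w ++ w').
Proof.
elim: w m => [|[i g] w IH] m /=; first by move/eqP->.
by case/andP=> -> /IH; apply.
Qed.

Lemma is_tangle_addr k m n w : is_tangle m n w -> is_tangle (m + k) (n + k) w.
Proof.
elim: w m => [|[i g] w IH] m /=; first by move/eqP->.
case/andP=> le_m /IH; rewrite (leq_trans le_m) ?leq_addr //=.
by rewrite -addnBAC ?(leq_trans _ le_m) ?leq_addl // addnAC.
Qed.

Lemma is_tangle_shift k m n w :
  is_tangle m n w -> is_tangle (k + m) (k + n) (shift k w).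
Proof.
elim: w m => [|[i g] w IH] m /=; first by move/eqP->.
case/andP=> le_m /IH; rewrite -addnA leq_add2l le_m /=.
by rewrite -addnBA ?(leq_trans _ le_m) ?leq_addl // addnA.
Qed.

Lemma is_tangle_otimes x y :
  is_tangle 2 2 x -> is_tangle 2 2 y -> is_tangle 2 2 (otimes x y).
Proof.
move=> x22 y22; apply: (@is_tangle_cat 2 4) => //.
apply: (is_tangle_cat (is_tangle_addr 2 x22)).
exact: (is_tangle_cat (is_tangle_shift 2 y22)).
Qed.

Lemma is_tangle_odot_pow x k : is_tangle 2 2 x -> is_tangle 2 2 (odot_pow x k).
Proof.
move=> x22; elim: k => [//|[|k] IH] //; exact: is_tangle_cat IH x22.
Qed.

Lemma is_tangle_otimes_pow x k :
  is_tangle 2 2 x -> is_tangle 2 2 (otimes_pow x k).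
Proof.
move=> x22; elim: k => [//|[|k] IH] //; exact: is_tangle_otimes IH x22.
Qed.

Lemma is_tangle_two_bridge b d i : is_tangle 2 2 (two_bridge_tangle b d i).
Proof.
have vert k : is_tangle 2 2 (vertical_row k).
  by case: k => k; apply: is_tangle_odot_pow.
elim: i => [|i IH]; first exact: is_tangle_otimes.
apply: is_tangle_cat (vert _); apply: is_tangle_otimes => //.
by case: (d _) => k; apply: is_tangle_otimes_pow.
Qed.

Lemma is_link_two_bridge b d n : is_link (two_bridge b d n).
Proof.
apply: (@is_tangle_cat 0 4) => //.
apply: (@is_tangle_cat _ 4) => //.
exact: (is_tangle_addr 1 (is_tangle_shift 1 (is_tangle_two_bridge b d n))).
Qed.

(* Main.v *)
Require Import Defs.
From mathcomp Require Import all_boot all_order all_algebra.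
From mathcomp Require Import ring.

(** Fix a disk in a link diagram and let a 4-ended tangle vary inside it.  By
    the skein relation the value of the invariant is a fixed linear combination
    of its values on three tangles, and the coefficients do not depend on what
    lies outside the disk.  So a tangle acts as a vector of a three-dimensional
    space, on which [otimes] and [odot] induce two commutative products.

    Each product has a unit u (the neutral crossingless tangle), an element p
    (the other crossingless tangle) and a generator g (a crossing), subject to
    p p = loop p, g p = p g = a^-1 p and g g = u + z g - z a^-1 p with
    z = q - q^-1.  Hence g satisfies (g - q)(g + q^-1)(g - a^-1) = 0, the
    product is diagonal in the basis of the three idempotents of g, and a row
    of k crossings has the coordinates q^k, (-q^-1)^k, a^-k.  All this only
    needs the nine products of basis tangles ([stacking_otimes],
    [stacking_odot]), which short explicit isotopies reduce to the skein and
    curl relations.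

    Rotating the square exchanges the two products, and the two idempotent
    bases are related by the matrix M in both directions
    ([idempotents_transition]).  In the basis for [otimes], appending a
    horizontal row therefore multiplies the coordinates by D(k), and appending
    a vertical row multiplies them by M D(k) M = B(k).  The tangle T_1 is
    isotopic to a vertical row, whose coordinates M (q^k, (-q^-1)^k, a^-k) are
    B_1(k) (1, 1, 1).  Finally the closure kills the first two idempotents and
    sends the third one, loop^-1 I_v, to loop^-1 loop^2 = loop: this is the row
    vector (0, 0, loop).

    The argument takes place over any field in which the relevant denominators
    do not vanish, with parameters a and q for alpha and s. *)

Set Implicit Arguments.
Unset Strict Implicit.
Unset Printing Implicit Defensive.

Import GRing.Theory.
Local Open Scope ring_scope.

(** * Diagrams in context *)

Lemma shift_cat k w w' : shift k (w ++ w') = shift k w ++ shift k w'.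
Proof. exact: map_cat. Qed.

Lemma shift_shift k l w : shift k (shift l w) = shift (k + l) w.
Proof. by rewrite /shift -map_comp; apply: eq_map => g /=; rewrite addnA. Qed.

Lemma local_move_shift k w w' :
  local_move w w' -> local_move (shift k w) (shift k w').
Proof.
case=> [i l g h|i|i|i o|i o|i o|i o|i o] /=; rewrite ?addnS ?addnA.
- exact: move_exchange.
- exact: move_zigzag_right.
- exact: move_zigzag_left.
- exact: move_slide_max.
- exact: move_slide_min.
- exact: move_R2.
- exact: move_R3.
- exact: move_framed_R1.
Qed.

Lemma is_tangle_double_twist m n u i o o1 o2 w :
  is_tangle m n (u ++ (i, Cross o) :: w) ->
  is_tangle m n (u ++ (i, Cross o1) :: (i, Cross o2) :: w).
Proof.
elim: u m => [|[j g] u IH] m /=; last by case/andP=> -> /IH.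
by case/andP=> im; rewrite !subnK ?(leq_trans _ im) ?leq_addl // im.
Qed.

Lemma is_tangle_drop_twist m n u i o w :
  is_tangle m n (u ++ (i, Cross o) :: w) -> is_tangle m n (u ++ w).
Proof.
elim: u m => [|[j g] u IH] m /=; last by case/andP=> -> /IH.
by case/andP=> im; rewrite subnK ?(leq_trans _ im) ?leq_addl.
Qed.

(** A disk containing a 4-ended tangle, in a link diagram: the surroundings of
    the disk consist of the diagrams above and below it and of the numbers of
    strands that pass on its left and on its right. *)
Record context := Context {
  above : word; left : nat; right : nat; below : word;
  above_tangle : is_tangle 0 (left + 2 + right) above;
  below_tangle : is_tangle (left + 2 + right) 0 below
}.

Definition plug (C : context) (t : word) : word :=
  above C ++ shift (left C) t ++ below C.

Lemma is_tangle_widen l r m n w :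
  is_tangle m n w -> is_tangle (l + m + r) (l + n + r) (shift l w).
Proof. by move=> mn; apply/is_tangle_addr/is_tangle_shift. Qed.

Lemma is_link_plug C t : is_tangle 2 2 t -> is_link (plug C t).
Proof.
move=> t22; apply: (is_tangle_cat (above_tangle C)).
exact: (is_tangle_cat (is_tangle_widen _ _ t22) (below_tangle C)).
Qed.

Lemma plug_cat C p t r :
  plug C (p ++ t ++ r) =
  (above C ++ shift (left C) p) ++ shift (left C) t ++
  (shift (left C) r ++ below C).
Proof. by rewrite /plug !shift_cat -!catA. Qed.

(** The next four lemmas are the bilinearity of the two operations: when one
    of the tangles is fixed, the remaining slot is again a disk in a diagram. *)
Lemma odot_above C y : is_tangle 2 2 y ->
  exists C', forall x, plug C' x = plug C (odot x y).
Proof.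
move=> y22.
exists (Context (above_tangle C)
  (is_tangle_cat (is_tangle_widen (left C) (right C) y22)
    (below_tangle C))) => x.
by rewrite /plug /= /odot shift_cat -!catA.
Qed.

Lemma odot_below C x : is_tangle 2 2 x ->
  exists C', forall y, plug C' y = plug C (odot x y).
Proof.
move=> x22.
exists (Context
  (is_tangle_cat (above_tangle C) (is_tangle_widen (left C) (right C) x22))
  (below_tangle C)) => y.
by rewrite /plug /= /odot shift_cat -!catA.
Qed.

Lemma otimes_left C y : is_tangle 2 2 y ->
  exists C', forall x, plug C' x = plug C (otimes x y).
Proof.
move=> y22.
have up : is_tangle 0 (left C + 2 + (2 + right C))
            (above C ++ shift (left C) [:: (1, Max)]).
  have -> : (left C + 2 + (2 + right C) = left C + 4 + right C)%N
    by rewrite -!addnA.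
  apply: (is_tangle_cat (above_tangle C)).
  exact: (@is_tangle_widen _ _ 2 4).
have down : is_tangle (left C + 2 + (2 + right C)) 0
              (shift (left C) (shift 2 y ++ [:: (1, Min)]) ++ below C).
  have -> : (left C + 2 + (2 + right C) = left C + 4 + right C)%N
    by rewrite -!addnA.
  apply: is_tangle_cat (below_tangle C); apply: is_tangle_widen.
  exact: (is_tangle_cat (is_tangle_shift 2 y22)).
by exists (Context up down) => x; rewrite /plug /otimes /= !shift_cat -!catA.
Qed.

Lemma otimes_right C x : is_tangle 2 2 x ->
  exists C', forall y, plug C' y = plug C (otimes x y).
Proof.
move=> x22.
have shape : (left C + 2 + 2 + right C = left C + 4 + right C)%N
  by rewrite -!addnA.
have up : is_tangle 0 (left C + 2 + 2 + right C)
            (above C ++ shift (left C) ([:: (1, Max)] ++ x)).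
  rewrite shape; apply: (is_tangle_cat (above_tangle C)).
  apply: is_tangle_widen; apply: (@is_tangle_cat 2 4) => //.
  exact: (is_tangle_addr 2 x22).
have down : is_tangle (left C + 2 + 2 + right C) 0
              (shift (left C) [:: (1, Min)] ++ below C).
  rewrite shape; apply: is_tangle_cat (below_tangle C).
  exact: (@is_tangle_widen _ _ 4 2).
exists (Context up down) => y.
by rewrite /plug /otimes /= !shift_cat shift_shift -!catA.
Qed.

(** * Invariants with skein and curl relations *)

Section SkeinInvariant.

Variables (F : fieldType) (a q : F) (K : word -> F).

Hypothesis a_neq0 : a != 0.
Hypothesis q_neq0 : q != 0.
Hypothesis q_sqr_neq1 : q ^+ 2 - 1 != 0.
Hypothesis q_sqr_neqN1 : q ^+ 2 + 1 != 0.

Local Notation z := (q - q^-1).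
Definition loop : F := (a - a^-1) / (q - q^-1) + 1.
Hypothesis loop_neq0 : loop != 0.

Hypothesis K_isotopy : forall L L', framed_isotopic L L' -> K L = K L'.
Hypothesis K_empty : K [::] = 1.
Hypothesis K_skein : forall (u v : word) (i : nat),
  is_link (u ++ shift i sigma ++ v) ->
  K (u ++ shift i sigma ++ v) - K (u ++ shift i sigma_inv ++ v) =
  z * (K (u ++ shift i I_v ++ v) - K (u ++ shift i I_h ++ v)).
Hypothesis K_curl : forall (u v : word) (i : nat),
  is_link (u ++ shift i (sigma_inv ++ [:: (0%N, Min)]) ++ v) ->
  K (u ++ shift i (sigma_inv ++ [:: (0%N, Min)]) ++ v) =
  a * K (u ++ shift i [:: (0%N, Min)] ++ v).
Hypothesis K_circle : forall L : word, is_link L ->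
  K (L ++ [:: (0%N, Max); (0%N, Min)]) = loop * K L.

Lemma z_neq0 : z != 0.
Proof.
apply: contraNneq q_sqr_neq1 => z0; have -> : q ^+ 2 - 1 = q * z by field.
by rewrite z0 mulr0.
Qed.

(** The algebra of tangles treats loop as an independent nonzero scalar subject
    to this relation. *)
Lemma z_loop : z * loop = a - a^-1 + z.
Proof. by rewrite /loop mulrDr mulr1 mulrC divfK ?z_neq0. Qed.

Lemma K_move u v w w' : local_move w w' ->
  is_link (u ++ w ++ v) -> is_link (u ++ w' ++ v) ->
  K (u ++ w ++ v) = K (u ++ w' ++ v).
Proof. by move=> mv Lw Lw'; apply/K_isotopy/isotopic_move. Qed.

Definition curl_factor (o : bool) : F := if o then a^-1 else a.

(** The given curl is the case of [Cross false].  For the other crossing,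
    [Cross true; Cross false; Min] is isotopic to [Min], and removing the lower
    crossing as a curl leaves the wanted diagram times a. *)
Lemma K_min_curl u v i o : is_link (u ++ [:: (i, Cross o); (i, Min)] ++ v) ->
  K (u ++ [:: (i, Cross o); (i, Min)] ++ v) =
  curl_factor o * K (u ++ [:: (i, Min)] ++ v).
Proof.
have curl u' : is_link (u' ++ [:: (i, Cross false); (i, Min)] ++ v) ->
    K (u' ++ [:: (i, Cross false); (i, Min)] ++ v) =
    a * K (u' ++ [:: (i, Min)] ++ v).
  by have := @K_curl u' v i; rewrite /shift /= addn0.
case: o => L; last exact: curl.
have L2 := is_tangle_double_twist true false L.
have R2 : K (u ++ [:: (i, Cross true); (i, Cross false)] ++ (i, Min) :: v) =
    K (u ++ [::] ++ (i, Min) :: v).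
  exact: K_move (move_R2 i true) L2 (is_tangle_drop_twist L).
have /= := curl (u ++ [:: (i, Cross true)]); rewrite -!catA => /(_ L2) eqK.
by rewrite /= -[K (u ++ (i, Min) :: v)]R2 eqK mulKf.
Qed.

(** ** Isotopy, skein and curl relations inside a disk *)

Section InContext.

Variable C : context.

Lemma plug_move p w w' r t t' : local_move w w' ->
  t = p ++ w ++ r -> t' = p ++ w' ++ r -> is_tangle 2 2 t -> is_tangle 2 2 t' ->
  K (plug C t) = K (plug C t').
Proof.
move=> mv -> -> t22 t'22; rewrite !plug_cat; apply: K_move.
- exact: local_move_shift.
- by rewrite -plug_cat; apply: is_link_plug.
- by rewrite -plug_cat; apply: is_link_plug.
Qed.

(** The lemmas below are stated with an arbitrary value x so that a chain of
    isotopies is a sequence of [apply:]. *)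
Lemma plug_rewrite p w w' r x : local_move w w' ->
  is_tangle 2 2 (p ++ w ++ r) -> is_tangle 2 2 (p ++ w' ++ r) ->
  K (plug C (p ++ w' ++ r)) = x -> K (plug C (p ++ w ++ r)) = x.
Proof. by move=> mv H1 H2 <-; apply: plug_move mv _ _ _ _. Qed.

Lemma plug_rewrite_back p w w' r x : local_move w w' ->
  is_tangle 2 2 (p ++ w' ++ r) -> is_tangle 2 2 (p ++ w ++ r) ->
  K (plug C (p ++ w ++ r)) = x -> K (plug C (p ++ w' ++ r)) = x.
Proof. by move=> mv H1 H2 <-; apply/esym; apply: plug_move mv _ _ _ _. Qed.

Lemma plug_min_curl p r i o x :
  is_tangle 2 2 (p ++ [:: (i, Cross o); (i, Min)] ++ r) ->
  K (plug C (p ++ [:: (i, Min)] ++ r)) = x ->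
  K (plug C (p ++ [:: (i, Cross o); (i, Min)] ++ r)) = curl_factor o * x.
Proof.
move=> t22 <-; rewrite !plug_cat; apply: K_min_curl.
by have := is_link_plug C t22; rewrite plug_cat.
Qed.

Lemma plug_skein p r i : is_tangle 2 2 (p ++ (i, Cross true) :: r) ->
  K (plug C (p ++ (i, Cross true) :: r)) -
  K (plug C (p ++ (i, Cross false) :: r)) =
  z * (K (plug C (p ++ r)) - K (plug C (p ++ (i, Min) :: (i, Max) :: r))).
Proof.
move=> t22.
have := is_link_plug C t22.
have := @K_skein (above C ++ shift (left C) p)
  (shift (left C) r ++ below C) (left C + i).
rewrite /plug /shift /= addn0 !map_cat /= -!catA /=.
by move=> + L; apply.
Qed.

Local Notation val t := (K (plug C t)).

Lemma I_h_otimes_I_v : val (otimes I_h I_v) = val I_v.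
Proof.
apply: (plug_rewrite (p := [::]) (r := [:: (0, Max); (1, Min)])
  (move_zigzag_right 0)) => //.
exact: (plug_rewrite (p := [::]) (r := [::]) (move_zigzag_left 0)).
Qed.

Lemma I_h_otimes_I_h : val (otimes I_h I_h) = val I_h.
Proof.
apply: (plug_rewrite (p := [::])
  (r := [:: (0, Max); (2, Min); (2, Max); (1, Min)]) (move_zigzag_right 0)) => //.
apply: (plug_rewrite (p := [:: (0, Max); (2, Min)]) (r := [::])
  (move_zigzag_right 1)) => //.
exact: (plug_rewrite (p := [::]) (r := [::]) (move_exchange 0 0 Max Min)).
Qed.

Lemma I_h_otimes_sigma_inv : val (otimes I_h sigma_inv) = val sigma_inv.
Proof.
apply: (plug_rewrite (p := [::])
  (r := [:: (0, Max); (2, Cross false); (1, Min)]) (move_zigzag_right 0)) => //.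
apply: (plug_rewrite (p := [::]) (r := [:: (1, Min)])
  (move_exchange 0 0 Max (Cross false))) => //.
exact: (plug_rewrite (p := sigma_inv) (r := [::]) (move_zigzag_left 0)).
Qed.

Lemma I_v_otimes_I_h : val (otimes I_v I_h) = val I_v.
Proof.
apply: (plug_rewrite (p := [::]) (r := [:: (2, Max); (1, Min)])
  (move_zigzag_left 1)) => //.
exact: (plug_rewrite (p := [::]) (r := [::]) (move_zigzag_right 1)).
Qed.

Lemma sigma_inv_otimes_I_h : val (otimes sigma_inv I_h) = val sigma_inv.
Proof.
apply: (plug_rewrite (p := [:: (1, Max); (0, Cross false); (2, Min)])
  (r := [::])
  (move_zigzag_right 1)) => //.
apply: (plug_rewrite (p := [:: (1, Max)]) (r := [::])
  (move_exchange 0 0 (Cross false) Min)) => //.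
exact: (plug_rewrite (p := [::]) (r := sigma_inv) (move_zigzag_left 1)).
Qed.

(** Sliding the crossing across the maximum turns the kink into a curl at the
    minimum, and exchanges over and under in the sense of [Cross]. *)
Lemma twist_otimes_I_v o :
  val (otimes [:: (0, Cross o)] I_v) = curl_factor (~~ o) * val I_v.
Proof.
rewrite -{1}[o]negbK.
apply: (plug_rewrite_back (p := [::]) (r := [:: (1, Min)])
  (move_slide_max 0 (~~ o))) => //.
apply: (plug_min_curl (p := [:: (0, Max)]) (r := [::])) => //.
exact: (plug_rewrite (p := [::]) (r := [::]) (move_zigzag_left 0)).
Qed.

Lemma I_v_otimes_twist o :
  val (otimes I_v [:: (0, Cross o)]) = curl_factor (~~ o) * val I_v.
Proof.
apply: (plug_rewrite (p := [::]) (r := [:: (1, Min)])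
  (move_slide_max 1 o)) => //.
apply: (plug_min_curl (p := [:: (2, Max)]) (r := [::])) => //.
exact: (plug_rewrite (p := [::]) (r := [::]) (move_zigzag_right 1)).
Qed.

(** The circle lies between the two outer arcs, in the middle of a diagram, so
    [K_circle] does not apply to it.  Its value comes from the skein relation at
    a kink: for both crossings the kink is a known multiple of I_v, and of the
    two smoothings one is I_v and the other one contains the circle. *)
Lemma I_v_otimes_I_v : val (otimes I_v I_v) = loop * val I_v.
Proof.
have := @plug_skein [:: (1, Max)] [:: (1, Min)] 0 isT.
have -> := twist_otimes_I_v true; have -> := twist_otimes_I_v false.
have -> : val ([:: (1, Max)] ++ [:: (0, Min), (0, Max) & [:: (1, Min)]]) = val I_v.
  exact: I_h_otimes_I_v.
move=> /= eqK; apply: (mulfI z_neq0); rewrite mulrA z_loop.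
by transitivity (a * val I_v - a^-1 * val I_v + z * val I_v);
  [rewrite eqK|]; ring.
Qed.

(** Sliding both crossings, across the maximum and across the minimum, puts
    them on the same two strands, where they cancel. *)
Lemma sigma_inv_otimes_sigma : val (otimes sigma_inv sigma) = val I_h.
Proof.
apply: (plug_rewrite_back (p := [::]) (r := [:: (2, Cross true); (1, Min)])
  (move_slide_max 0 true)) => //.
apply: (plug_rewrite (p := [:: (0, Max); (1, Cross true)]) (r := [::])
  (move_slide_min 1 true)) => //.
apply: (plug_rewrite (p := [:: (0, Max)]) (r := [:: (2, Min)])
  (move_R2 1 true)) => //.
exact: (plug_rewrite (p := [::]) (r := [::]) (move_exchange 0 0 Max Min)).
Qed.

Lemma sigma_inv_otimes_sigma_inv : val (otimes sigma_inv sigma_inv) =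
  val I_h + z * val sigma_inv - z * a^-1 * val I_v.
Proof.
have := @plug_skein [:: (1, Max); (0, Cross false)] [:: (1, Min)] 2 isT.
have -> := sigma_inv_otimes_sigma; have -> := twist_otimes_I_v false.
have -> := sigma_inv_otimes_I_h.
rewrite /= => eqK; rewrite -[LHS](subKr (val I_h)) eqK; ring.
Qed.

Lemma twist_odot_I_h o :
  val (odot [:: (0, Cross o)] I_h) = curl_factor o * val I_h.
Proof. exact: (plug_min_curl (p := [::]) (r := [:: (0, Max)])). Qed.

(** Here the curl sits at a maximum.  A zigzag created on one of its strands
    changes it into a kink on a vertical strand; the framed Reidemeister I move
    reverses the rotation of the kink, which can then be slid into a curl at a
    minimum. *)
Lemma I_h_odot_twist o :
  val (odot I_h [:: (0, Cross o)]) = curl_factor o * val I_h.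
Proof.
(* Create the zigzag and move its maximum up to the top of the disk. *)
apply: (plug_rewrite_back (p := [:: (0, Min); (0, Max); (0, Cross o)])
  (r := [::])
  (move_zigzag_right 1)) => //.
apply: (plug_rewrite (p := [:: (0, Min); (0, Max)]) (r := [:: (1, Min)])
  (move_exchange 0 0 (Cross o) Max)) => //.
apply: (plug_rewrite (p := [:: (0, Min)]) (r := [:: (0, Cross o); (1, Min)])
  (move_exchange 0 0 Max Max)) => //.
(* The crossing and the new minimum now form a kink. *)
rewrite -[in Cross o](negbK o).
apply: (plug_rewrite_back (p := [:: (0, Min); (0, Max); (0, Max)]) (r := [::])
  (move_slide_min 0 (~~ o))) => //.
apply: (plug_rewrite_back (p := [:: (0, Min); (0, Max)]) (r := [::])
  (move_framed_R1 0 (~~ o))) => //.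
apply: (plug_rewrite_back (p := [:: (0, Min); (0, Max)]) (r := [:: (1, Min)])
  (move_slide_max 0 o)) => //.
apply: (plug_min_curl (p := [:: (0, Min); (0, Max); (0, Max)]) (r := [::])) => //.
exact: (plug_rewrite (p := I_h) (r := [::]) (move_zigzag_left 0)).
Qed.

(** The skein relation above the minimum of I_h, where both crossings are
    curls. *)
Lemma I_h_odot_I_h : val (odot I_h I_h) = loop * val I_h.
Proof.
have := @plug_skein [::] I_h 0 isT.
have -> := twist_odot_I_h true; have -> := twist_odot_I_h false.
move=> /= eqK; apply: (mulfI z_neq0); rewrite mulrA z_loop.
by transitivity (z * val I_h - (a^-1 * val I_h - a * val I_h));
  [rewrite eqK|]; ring.
Qed.

Lemma sigma_odot_sigma_inv : val (odot sigma sigma_inv) = val I_v.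
Proof. exact: (plug_rewrite (p := [::]) (r := [::]) (move_R2 0 true)). Qed.

Lemma sigma_odot_sigma : val (odot sigma sigma) =
  val I_v + z * val sigma - z * a^-1 * val I_h.
Proof.
have := @plug_skein sigma [::] 0 isT.
have -> := sigma_odot_sigma_inv; have -> := twist_odot_I_h true.
move=> /= eqK; rewrite -[LHS](subrK (val I_v)) eqK; ring.
Qed.

End InContext.

(** * Idempotent coordinates *)

(** In the algebra with unit u, turnback p and generator g, the idempotents
    e_1, e_2, e_3 for the eigenvalues q, - q^-1, a^-1 of g, as linear
    combinations of u, p, g.  They are found from e_3 = loop^-1 p,
    e_1 + e_2 = u - e_3 and q e_1 - q^-1 e_2 = g - a^-1 e_3. *)
Definition idempotents (u p g : F) : 'rV[F]_3 := \row_j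
  [:: (g - a^-1 * loop^-1 * p + q^-1 * (u - loop^-1 * p)) / (q + q^-1);
      (q * (u - loop^-1 * p) - (g - a^-1 * loop^-1 * p)) / (q + q^-1);
      loop^-1 * p]`_j.

Definition col3 (x y w : F) : 'cV[F]_3 := \col_j [:: x; y; w]`_j.

Definition pointwise (X Y : 'cV[F]_3) : 'cV[F]_3 := \col_j (X j 0 * Y j 0).

Lemma forall_ord3 (P : 'I_3 -> Prop) : P 0 -> P 1 -> P 2%:R -> forall j, P j.
Proof.
move=> P0 P1 P2 [[|[|[|//]]] lt_j].
- by rewrite (_ : Ordinal lt_j = 0) //; apply: val_inj.
- by rewrite (_ : Ordinal lt_j = 1) //; apply: val_inj.
- by rewrite (_ : Ordinal lt_j = 2%:R) //; apply: val_inj.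
Qed.

Lemma dot3 (X : 'rV[F]_3) (Y : 'cV[F]_3) :
  (X *m Y) 0 0 = X 0 0 * Y 0 0 + X 0 1 * Y 1 0 + X 0 2%:R * Y 2%:R 0.
Proof.
rewrite mxE !big_ord_recl big_ord0 addr0 addrA.
by congr (_ * _ + _ * _ + _ * _); congr (_ _ _); apply: val_inj.
Qed.

Ltac skein_field :=
  by field; rewrite ?loop_neq0 ?a_neq0 ?q_neq0 -?expr2 ?q_sqr_neqN1.

Lemma idempotents_unit u p g : (idempotents u p g *m col3 1 1 1) 0 0 = u.
Proof. by rewrite dot3 !mxE /=; skein_field. Qed.

Lemma idempotents_generator u p g :
  (idempotents u p g *m col3 q (- q^-1) a^-1) 0 0 = g.
Proof. by rewrite dot3 !mxE /=; skein_field. Qed.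

Lemma idempotents_generatorV u p g :
  (idempotents u p g *m col3 q^-1 (- q) a) 0 0 = g - z * (u - p).
Proof.
transitivity (g - z * u + loop^-1 * (a - a^-1 + z) * p).
  by rewrite dot3 !mxE /=; skein_field.
by rewrite -z_loop; skein_field.
Qed.

(** The arguments p, loop * p, a^-1 * p are the products of p with u, p, g:
    multiplication by p is zero on e_1, e_2, and e_3 p = p. *)
Lemma idempotents_turnback_mul p (Y : 'cV[F]_3) :
  (idempotents p (loop * p) (a^-1 * p) *m Y) 0 0 = p * Y 2%:R 0.
Proof. by rewrite dot3 !mxE /=; skein_field. Qed.

(** The arguments on the left are the products of g with u, p, g: the lemma
    says that e_1, e_2, e_3 are eigenvectors of the multiplication by g. *)
Lemma idempotents_generator_mul u p g (Y : 'cV[F]_3) :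
  (idempotents g (a^-1 * p) (u + z * g - z * a^-1 * p) *m Y) 0 0 =
  (idempotents u p g *m pointwise (col3 q (- q^-1) a^-1) Y) 0 0.
Proof.
transitivity ((idempotents u p g *m pointwise (col3 q (- q^-1) a^-1) Y) 0 0 +
    (a - a^-1 + z - z * loop) * (a^-1 * loop^-1 * p * (Y 0 0 - Y 1 0) / (q + q^-1))).
  by rewrite !dot3 !mxE /=; skein_field.
by rewrite z_loop subrr mul0r addr0.
Qed.

(** Multiplication is pointwise in idempotent coordinates.  The three arguments
    on the left are the values of u y, p y, g y when y has coordinates Y. *)
Lemma idempotents_mul u p g (X Y : 'cV[F]_3) :
  (idempotents ((idempotents u p g *m Y) 0 0)
     ((idempotents p (loop * p) (a^-1 * p) *m Y) 0 0)
     ((idempotents g (a^-1 * p) (u + z * g - z * a^-1 * p) *m Y) 0 0) *m X) 0 0 =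
  (idempotents u p g *m pointwise X Y) 0 0.
Proof.
rewrite idempotents_turnback_mul idempotents_generator_mul !dot3 !mxE /=.
skein_field.
Qed.

Local Notation val C t := (K (plug C t)).

(** What [otimes] and [odot] have in common: bilinearity (in the form of the
    plugging conditions) and the multiplication table of u, p, g.  The tangle
    gV is the inverse of g. *)
Record stacking (op : word -> word -> word) (u p g gV : word)
  : Prop := Stacking {
  stack_tangle : forall x y,
    is_tangle 2 2 x -> is_tangle 2 2 y -> is_tangle 2 2 (op x y);
  stack_plugl : forall C y, is_tangle 2 2 y ->
    exists C', forall x, plug C' x = plug C (op x y);
  stack_plugr : forall C x, is_tangle 2 2 x ->
    exists C', forall y, plug C' y = plug C (op x y);
  stack_basis :
    [&& is_tangle 2 2 u, is_tangle 2 2 p, is_tangle 2 2 g & is_tangle 2 2 gV];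
  stack_uu : forall C, val C (op u u) = val C u;
  stack_up : forall C, val C (op u p) = val C p;
  stack_ug : forall C, val C (op u g) = val C g;
  stack_pu : forall C, val C (op p u) = val C p;
  stack_pp : forall C, val C (op p p) = loop * val C p;
  stack_pg : forall C, val C (op p g) = a^-1 * val C p;
  stack_gu : forall C, val C (op g u) = val C g;
  stack_gp : forall C, val C (op g p) = a^-1 * val C p;
  stack_gg : forall C,
    val C (op g g) = val C u + z * val C g - z * a^-1 * val C p;
  stack_gV : forall C, val C gV = val C g - z * (val C u - val C p)
}.

Section Stacking.

Variables (op : word -> word -> word) (u p g gV : word).
Hypothesis st : stacking op u p g gV.

Definition coordinates (t : word) (X : 'cV[F]_3) : Prop :=
  forall C, val C t = (idempotents (val C u) (val C p) (val C g) *m X) 0 0.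

(** The table is used one slot at a time: for a basis tangle on the left, y is
    expanded in its own slot, and then x in the slot that is left. *)
Lemma coordinates_op x y X Y : is_tangle 2 2 x -> is_tangle 2 2 y ->
  coordinates x X -> coordinates y Y -> coordinates (op x y) (pointwise X Y).
Proof.
move=> x22 y22 xX yY C.
have [u22 p22 g22 _] := and4P (stack_basis st).
have [Cy plug_y] := stack_plugl st C y22.
have slot t : is_tangle 2 2 t -> val C (op t y) =
    (idempotents (val C (op t u)) (val C (op t p)) (val C (op t g)) *m Y) 0 0.
  by move=> t22; have [Ct plug_t] := stack_plugr st C t22; rewrite -!plug_t yY.
rewrite -plug_y xX !plug_y !slot // (stack_uu st) (stack_up st) (stack_ug st).
rewrite (stack_pu st) (stack_pp st) (stack_pg st) (stack_gu st) (stack_gp st).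
by rewrite (stack_gg st) idempotents_mul.
Qed.

(* Both kinds of rows are defined by the same recursion; abstracting it makes
   the next lemmas apply to either. *)
Variables (pow : word -> nat -> word) (row : int -> word).
Hypothesis pow0 : forall x, pow x 0 = u.
Hypothesis pow1 : forall x, pow x 1 = x.
Hypothesis powSS : forall x k, pow x k.+2 = op (pow x k.+1) x.
Hypothesis row_Posz : forall n : nat, row n = pow g n.
Hypothesis row_Negz : forall n, row (Negz n) = pow gV n.+1.

Lemma is_tangle_pow x k : is_tangle 2 2 x -> is_tangle 2 2 (pow x k).
Proof.
have [u22 _ _ _] := and4P (stack_basis st).
move=> x22; elim: k => [|[|k] IH]; first by rewrite pow0.
  by rewrite pow1.
by rewrite powSS; apply: (stack_tangle st).
Qed.

Lemma coordinates_pow x x1 x2 x3 k : is_tangle 2 2 x ->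
  coordinates x (col3 x1 x2 x3) ->
  coordinates (pow x k) (col3 (x1 ^+ k) (x2 ^+ k) (x3 ^+ k)).
Proof.
move=> x22 xX; elim: k => [|[|k] IH].
- by move=> C; rewrite pow0 !expr0 idempotents_unit.
- by rewrite pow1 !expr1.
rewrite powSS.
have -> : col3 (x1 ^+ k.+2) (x2 ^+ k.+2) (x3 ^+ k.+2) =
    pointwise (col3 (x1 ^+ k.+1) (x2 ^+ k.+1) (x3 ^+ k.+1)) (col3 x1 x2 x3).
  by apply/colP; elim/forall_ord3; rewrite !mxE /= -exprSr.
by apply: coordinates_op => //; apply: is_tangle_pow.
Qed.

Definition twist_eigenvalues (k : int) : 'rV[F]_3 :=
  \row_j [:: q ^ k; (- q^-1) ^ k; a ^ (- k)]`_j.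

Lemma coordinates_row k : coordinates (row k) (twist_eigenvalues k)^T.
Proof.
have [_ _ g22 gV22] := and4P (stack_basis st).
case: k => n.
  have -> : (twist_eigenvalues n)^T = col3 (q ^+ n) ((- q^-1) ^+ n) (a^-1 ^+ n).
    by apply/colP; elim/forall_ord3; rewrite !mxE //= -exprnN exprVn.
  rewrite row_Posz; apply: coordinates_pow => // C.
  by rewrite idempotents_generator.
have -> : (twist_eigenvalues (Negz n))^T =
    col3 (q^-1 ^+ n.+1) ((- q) ^+ n.+1) (a ^+ n.+1).
  apply/colP; elim/forall_ord3; rewrite !mxE //= ?NegzE ?opprK //.
    by rewrite -exprnN exprVn.
  by rewrite -exprnN -exprVn invrN invrK.
rewrite row_Negz; apply: coordinates_pow => // C.
by rewrite idempotents_generatorV (stack_gV st).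
Qed.

End Stacking.

(** The columns of this matrix are the idempotents of one product in the basis
    of the idempotents of the other one. *)
Definition transition_entries : seq (seq F) :=
  [:: [:: (q^-1 - loop^-1 * q^-1 - loop^-1 * a^-1) / (q + q^-1);
          (- q^-1 - loop^-1 * q + loop^-1 * a^-1) / (q + q^-1);
          loop^-1];
      [:: (- q - loop^-1 * q^-1 - loop^-1 * a^-1) / (q + q^-1);
          (q - loop^-1 * q + loop^-1 * a^-1) / (q + q^-1);
          loop^-1];
      [:: (q^-1 * loop + a - loop^-1 * q^-1 - loop^-1 * a^-1) / (q + q^-1);
          (q * loop - a - loop^-1 * q + loop^-1 * a^-1) / (q + q^-1);
          loop^-1]].

Definition transition : 'M[F]_3 :=
  \matrix_(i, j) (nth [::] transition_entries i)`_j.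

(** Rotating the square by a quarter turn exchanges u and p and replaces the
    generator by its inverse, which is g + z (p - u) by the skein relation.  As
    the rotated basis is built in the same way, the same matrix also changes
    the bases back. *)
Lemma idempotents_transition u p g (X : 'cV[F]_3) :
  (idempotents p u (g + z * (p - u)) *m X) 0 0 =
  (idempotents u p g *m (transition *m X)) 0 0.
Proof.
transitivity ((idempotents u p g *m (transition *m X)) 0 0 +
    (z * loop - (a - a^-1 + z)) * (loop^-1 * p * (X 0 0 - X 1 0) / (q + q^-1))).
  rewrite mulmxA !dot3 !mxE !big_ord_recl !big_ord0 !mxE /=.
  skein_field.
by rewrite z_loop subrr mul0r addr0.
Qed.

(** * Two-bridge diagrams *)

Lemma val_sigma_inv C :
  val C sigma_inv = val C sigma - z * (val C I_v - val C I_h).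
Proof. by have /= <- := @plug_skein C [::] [::] 0 isT; rewrite subKr. Qed.

Lemma stacking_otimes : stacking otimes I_h I_v sigma_inv sigma.
Proof.
split=> //.
- exact: is_tangle_otimes.
- exact: otimes_left.
- exact: otimes_right.
- exact: I_h_otimes_I_h.
- exact: I_h_otimes_I_v.
- exact: I_h_otimes_sigma_inv.
- exact: I_v_otimes_I_h.
- exact: I_v_otimes_I_v.
- by move=> C; apply: (I_v_otimes_twist C false).
- exact: sigma_inv_otimes_I_h.
- by move=> C; apply: (twist_otimes_I_v C false).
- exact: sigma_inv_otimes_sigma_inv.
- by move=> C; rewrite val_sigma_inv; ring.
Qed.

Lemma stacking_odot : stacking odot I_v I_h sigma sigma_inv.
Proof.
split=> //.
- by move=> x y; apply: is_tangle_cat.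
- exact: odot_above.
- exact: odot_below.
- exact: I_h_odot_I_h.
- by move=> C; apply: (I_h_odot_twist C true).
- by move=> C; apply: (twist_odot_I_h C true).
- exact: sigma_odot_sigma.
- exact: val_sigma_inv.
Qed.

Local Notation coordinates_h := (coordinates I_h I_v sigma_inv).
Local Notation coordinates_v := (coordinates I_v I_h sigma).

Lemma coordinates_horizontal_row k :
  coordinates_h (horizontal_row k) (twist_eigenvalues k)^T.
Proof. exact: (coordinates_row stacking_otimes (pow := otimes_pow)). Qed.

Lemma coordinates_vertical_row k :
  coordinates_v (vertical_row k) (twist_eigenvalues k)^T.
Proof. exact: (coordinates_row stacking_odot (pow := odot_pow)). Qed.

Lemma coordinates_h_v t X :
  coordinates_h t X -> coordinates_v t (transition *m X).
Proof.
move=> tX C; rewrite tX val_sigma_inv -idempotents_transition.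
by congr (((idempotents _ _ _) *m X) 0 0); ring.
Qed.

Lemma coordinates_v_h t X :
  coordinates_v t X -> coordinates_h t (transition *m X).
Proof.
move=> tX C; rewrite tX -idempotents_transition val_sigma_inv.
by congr (((idempotents _ _ _) *m X) 0 0); ring.
Qed.

Lemma pointwise_diag (X : 'cV[F]_3) (Y : 'rV[F]_3) :
  pointwise X Y^T = diag_mx Y *m X.
Proof. by apply/colP => j; rewrite mul_diag_mx !mxE mulrC. Qed.

Definition horizontal_mx (k : int) : 'M[F]_3 := diag_mx (twist_eigenvalues k).

Definition vertical_mx (k : int) : 'M[F]_3 :=
  transition *m horizontal_mx k *m transition.

Definition initial_mx (k : int) : 'M[F]_3 :=
  diag_mx (\row_i (transition i 0 * q ^ k + transition i 1 * (- q^-1) ^ k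
                   + transition i 2%:R * a ^ (- k))).

Lemma is_tangle_vertical_row k : is_tangle 2 2 (vertical_row k).
Proof. by case: k => k; apply: is_tangle_odot_pow. Qed.

Lemma is_tangle_horizontal_row k : is_tangle 2 2 (horizontal_row k).
Proof. by case: k => k; apply: is_tangle_otimes_pow. Qed.

(** I_h is the unit of [otimes], so its coordinates are all 1; those of the
    vertical row are changed to the basis for [otimes] by the transition
    matrix. *)
Lemma coordinates_initial k :
  coordinates_h (otimes I_h (vertical_row k)) (initial_mx k *m const_mx 1).
Proof.
have -> : initial_mx k *m const_mx 1 =
    pointwise (col3 1 1 1) (transition *m (twist_eigenvalues k)^T).
  apply/colP => j; rewrite mul_diag_mx !mxE mulr1 !big_ord_recl big_ord0 !mxE /=.
  have -> : [:: 1; 1; 1]`_j = 1 :> F by move: j; elim/forall_ord3.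
  by rewrite mul1r addr0 addrA.
apply: (coordinates_op stacking_otimes) => //.
- exact: is_tangle_vertical_row.
- by move=> C; rewrite idempotents_unit.
- exact: coordinates_v_h (coordinates_vertical_row k).
Qed.

Lemma coordinates_two_bridge_step t k l X : is_tangle 2 2 t ->
  coordinates_h t X ->
  coordinates_h (odot (otimes t (horizontal_row k)) (vertical_row l))
    (vertical_mx l *m horizontal_mx k *m X).
Proof.
move=> t22 tX; rewrite -!mulmxA; apply: coordinates_v_h.
rewrite -pointwise_diag.
apply: (coordinates_op stacking_odot).
- exact: is_tangle_otimes (is_tangle_horizontal_row k).
- exact: is_tangle_vertical_row.
- apply: coordinates_h_v; rewrite -pointwise_diag.
  apply: (coordinates_op stacking_otimes) => //.
    exact: is_tangle_horizontal_row.
  exact: coordinates_horizontal_row.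
- exact: coordinates_vertical_row.
Qed.

Lemma coordinates_two_bridge b d n :
  coordinates_h (two_bridge_tangle b d n)
    ((\prod_(0 <= i < n)
         (vertical_mx (b (n - i).+1) *m horizontal_mx (d (n - i)%N)))
     *m (initial_mx (b 1%N) *m const_mx 1)).
Proof.
elim: n => [|n IH]; first by rewrite big_nil mul1mx; apply: coordinates_initial.
rewrite big_nat_recl // subn0 -[_ * _]/(_ *m _) -mulmxA.
apply: coordinates_two_bridge_step (is_tangle_two_bridge b d n) _.
exact: IH.
Qed.

Lemma closure_basis :
  [/\ K (Defs.closure I_v) = loop ^+ 2, K (Defs.closure I_h) = loop &
      K (Defs.closure sigma_inv) = a^-1 * loop].
Proof.
have circle : K [:: (0, Max); (0, Min)] = loop.
  by have := @K_circle [::] isT; rewrite K_empty mulr1.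
split.
(* The two maxima belong to side-by-side circles, which an exchange stacks. *)
- rewrite -circle expr2 {1}circle -K_circle //.
  exact/esym/(@K_move [:: (0, Max)] [:: (0, Min)] _ _ (move_exchange 0 0 Min Max)).
- rewrite -circle.
  rewrite -[LHS]/(K
    ([:: (0, Max)] ++ [:: (2, Max); (1, Min)] ++ [:: (1, Max); (0, Min); (0, Min)])).
  rewrite (K_move (move_zigzag_right 1)) //.
  exact: (@K_move [:: (0, Max)] [:: (0, Min)] _ _ (move_zigzag_right 0)).
- rewrite -circle.
  rewrite -[LHS]/(K
    ([:: (0, Max); (2, Max)] ++ [:: (1, Cross false); (0, Min)] ++ [:: (0, Min)])).
  rewrite (K_move (move_slide_min 0 false)) //.
  rewrite -[LHS]/(K
    ([:: (0, Max)] ++ [:: (2, Max); (0, Cross true)] ++ [:: (1, Min); (0, Min)])).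
  rewrite -(K_move (move_exchange 0 0 (Cross true) Max)) //.
  rewrite -[LHS]/(K
    ([:: (0, Max); (0, Cross true)] ++ [:: (2, Max); (1, Min)] ++ [:: (0, Min)])).
  rewrite (K_move (move_zigzag_right 1)) //.
  exact: (@K_min_curl [:: (0, Max)] [::] 0 true).
Qed.

Lemma closure_context : exists C, forall t, plug C t = Defs.closure t.
Proof.
by exists (@Context [:: (0, Max); (2, Max)] 1 1 [:: (0, Min); (0, Min)] isT isT).
Qed.

(** By [closure_basis], closing up is the linear form that sends the unit, the
    turnback and the generator to loop times 1, loop and a^-1.  These factors
    are the third idempotent coordinates of the three tangles, so the form is
    loop times the third coordinate. *)
Lemma coordinates_closure t X :
  coordinates_h t X -> K (Defs.closure t) =
  ((\row_j [:: 0; 0; loop]`_j) *m X) 0 0.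
Proof.
have [C plugC] := closure_context; have [Kv Kh Ks] := closure_basis.
move=> tX; rewrite -plugC tX !plugC Kv Kh Ks; congr ((_ *m X) 0 0).
apply/rowP; elim/forall_ord3; rewrite !mxE /=; by skein_field.
Qed.

Theorem kauffman_two_bridge b d n :
  K (two_bridge b d n) =
    ((\row_(j < 3) [:: 0; 0; loop]`_j : 'rV[F]_3)
     *m (\prod_(0 <= i < n)
         (vertical_mx (b (n - i).+1) *m horizontal_mx (d (n - i)%N)))
     *m initial_mx (b 1%N)
     *m (const_mx 1 : 'cV[F]_3)) 0 0.
Proof.
by rewrite -!mulmxA; apply: coordinates_closure (coordinates_two_bridge b d n).
Qed.

End SkeinInvariant.

(** * The field of rational functions *)

(** The numerator of delta over the common denominator x y (y - y^-1). *)
Lemma skein_loop_neq0 (F : fieldType) (x y : F) :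
  x != 0 -> y != 0 -> y ^+ 2 - 1 != 0 ->
  (x ^+ 2 - 1) * y + (y ^+ 2 - 1) * x != 0 ->
  (x - x^-1) / (y - y^-1) + 1 != 0.
Proof.
move=> x0 y0 y21; apply: contraNneq => e.
have -> : (x ^+ 2 - 1) * y + (y ^+ 2 - 1) * x =
    x * y * (y - y^-1) * ((x - x^-1) / (y - y^-1) + 1).
  by field; rewrite x0 y0 -?expr2 ?y21.
by rewrite e mulr0.
Qed.

Lemma alpha_neq0 : alpha != 0.
Proof. by rewrite /alpha tofrac_eq0 polyC_eq0 polyX_eq0. Qed.

Lemma s_neq0 : s != 0.
Proof. by rewrite /s tofrac_eq0 polyX_eq0. Qed.

Lemma s_sqr_neq1 : s ^+ 2 - 1 != 0.
Proof.
rewrite -tofrac1 -tofracXn -tofracB tofrac_eq0.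
by rewrite -size_poly_eq0 size_XnsubC.
Qed.

Lemma s_sqr_neqN1 : s ^+ 2 + 1 != 0.
Proof.
rewrite -tofrac1 -tofracXn -tofracD tofrac_eq0.
by rewrite -size_poly_eq0 size_XnaddC.
Qed.

(** After clearing denominators delta becomes a polynomial in s over Q[alpha],
    whose coefficient of s^2 is alpha. *)
Lemma delta_neq0 : delta != 0.
Proof.
apply: (@skein_loop_neq0 Qas alpha s alpha_neq0 s_neq0 s_sqr_neq1).
rewrite -tofrac1 -!tofracXn -!tofracB -!tofracM -tofracD tofrac_eq0.
apply/eqP => /(congr1 (fun p : {poly {poly rat}} => p`_2)) /eqP.
rewrite coefD coefMX coefMC !coefB -rmorphXn coefC coefXn !coef1 /=.
by rewrite !subr0 mul1r add0r coef0 polyX_eq0.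
Qed.

Theorem theorem1 (K : word -> Qas) (HK : kauffman_polynomial K)
    (n : nat) (b d : nat -> int) (hn : (1 <= n)%N)
    (hb : forall i : nat, (1 <= i <= n.+1)%N -> b i != 0)
    (hd : forall i : nat, (1 <= i <= n)%N -> d i != 0) :
  K (two_bridge b d n) =
    ((\row_(j < 3) [:: 0; 0; delta]`_j : 'rV[Qas]_3)
     *m (\prod_(0 <= i < n) (Bmx (b (n - i).+1) *m Dmx (d (n - i)%N)))
     *m B1mx (b 1%N)
     *m (const_mx 1 : 'cV[Qas]_3)) 0 0.
Proof.
case: HK => K_isotopy K_empty K_skein K_curl K_circle.
exact: (@kauffman_two_bridge Qas alpha s K alpha_neq0 s_neq0
  s_sqr_neq1 s_sqr_neqN1 delta_neq0
  K_isotopy K_empty K_skein K_curl K_circle b d n).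
Qed.
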